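(* Let $X=(X,d,\mu)$ be an unbounded metric space equipped with a doubling measure $\mu$ such that $\mu(\{x\})=0$ for every $x\in X$, and such that the annulus $B(x,R)\setminus B(x,r)$ is non-empty for each $x\in X$ and all $0<r<R<\infty$. Let $0<s<1$ and assume that $X$ is Ahlfors $Q$-regular with $Q>s$, i.e., there exists $C_A\ge1$ such that $C_A^{-1}r^Q\le\mu(B(x,r))\le C_Ar^Q$ for each $x\in X$ and every $0<r<\infty$. Let $\emptyset\neq E\subset X$ be a closed set such that $\underline{\mathrm{co\,dim}}_A(E)>0$, write $\delta_E(x)=\operatorname{dist}(x,E)$, and let $1<p\le q\le Qp/(Q-sp)<\infty$ and $\beta\ge0$. Assume that for some $1\le t\le q$ and $C_H>0$ the fractional Hardy--Sobolev inequality $$\Bigl(\int_X|f(x)|^q\,\delta_E(x)^{(q/p)(Q-sp+\beta)-Q}\,d\mu(x)\Bigr)^{1/q}\le C_H\Bigl(\int_X\Bigl(\int_X\frac{|f(y)-f(z)|^t}{d(y,z)^{st}\,\mu(B(y,d(y,z)))}\,d\mu(z)\Bigr)^{p/t}\delta_E(y)^{\beta}\,d\mu(y)\Bigr)^{1/p}$$ holds for all functions $f\in\operatorname{Lip}_0(X)$. Then $$\underline{\mathrm{co\,dim}}_A(E)>Q-\frac qp(Q-sp+\beta).$$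
   Context: $X=(X,d,\mu)$ is a metric space with a Borel measure $\mu$ supported on $X$ such that $0<\mu(B)<\infty$ for every open ball $B=B(x,r)=\{y\in X:d(x,y)<r\}$, $x\in X$, $r>0$. The measure $\mu$ is doubling: there is $C_D>0$ with $\mu(B(x,2r))\le C_D\,\mu(B(x,r))$ for all $x\in X$, $r>0$. For $E\subset X$ and $r>0$ let $E_r=\{x\in X:\operatorname{dist}(x,E)<r\}$. The lower Assouad codimension $\underline{\mathrm{co\,dim}}_A(E)$ is the supremum of all $\rho\ge0$ for which there is a constant $C\ge1$ such that $\mu(E_r\cap B(x,R))/\mu(B(x,R))\le C(r/R)^{\rho}$ for every $x\in E$ and all $0<r<R<2\operatorname{diam}(X)$. $\operatorname{Lip}_0(X)$ is the set of all Lipschitz functions $f\colon X\to\mathbb{R}$ for which there is a ball $B$ with $f=0$ on $X\setminus B$. The inner integral is understood over $z\ne y$. *)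

(* Defs.v *)
From HB Require Import structures.
From mathcomp Require Import all_boot all_order all_algebra.
From mathcomp Require Import all_classical all_reals all_analysis.

Set Implicit Arguments.
Unset Strict Implicit.
Unset Printing Implicit Defensive.

Import Order.TTheory GRing.Theory Num.Theory.
Import numFieldNormedType.Exports.

Local Open Scope classical_set_scope.
Local Open Scope ring_scope.

(* [measurableType] inherits from [pointedType], so a metric space has to be
   pointed to carry its Borel sigma-algebra. *)
#[short(type="pmetricType")]
HB.structure Definition PointedMetric (K : numDomainType) :=
  {M of Metric K M & isPointed M}.

Notation borel X := (g_sigma_algebraType (@open X)).

(* [x `^ a] for [x >= 0], with the convention [0 `^ a = +oo] for [a < 0]
   (the library has [powR 0 a = 0] there). *)
Definition epow (R : realType) (x a : R) : \bar R :=
  if (x == 0) && (a < 0) then +oo%E else (x `^ a)%:E.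

Definition diam (R : realType) (X : metricType R) (A : set X) : \bar R :=
  ereal_sup [set (mdist x y)%:E | x in A & y in A].

(* The library's [edist] is defined from balls; on a metric space it is the
   distance, hence [edist_inf E x] is [inf_(a in E) mdist x a]. *)
Lemma edist_mdist (R : realType) (X : metricType R) (x y : X) :
  edist (x, y) = (mdist x y)%:E.
Proof.
apply/eqP; rewrite eq_le; apply/andP; split.
- apply/lee_addgt0Pr => e e0; apply: ereal_inf_lbound.
  exists (mdist x y + e) => //; split => /=.
    by rewrite ltr_wpDl // mdist_ge0.
  by rewrite ballEmdist /= ltrDl.
- apply: le_ereal_inf_tmp => _ [r [_ /= rxy] <-].
  by rewrite lee_fin; move: rxy; rewrite ballEmdist /= => /ltW.
Qed.

Definition delta (R : realType) (X : metricType R) (E : set X) (x : X) : R :=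
  fine (edist_inf E x).

Definition open_nbhd (R : realType) (X : metricType R) (E : set X) (r : R) :
  set X := [set x | (edist_inf E x < r%:E)%E].

Definition balls_finite_positive (R : realType) (X : pmetricType R)
    (mu : {measure set (borel X) -> \bar R}) : Prop :=
  forall (x : X) (r : R), 0 < r -> (0 < mu (ball x r) < +oo)%E.

Definition doubling (R : realType) (X : pmetricType R)
    (mu : {measure set (borel X) -> \bar R}) : Prop :=
  exists2 CD : R, 0 < CD & forall (x : X) (r : R), 0 < r ->
    (mu (ball x (2 * r)) <= CD%:E * mu (ball x r))%E.

Definition ahlfors_regular (R : realType) (X : pmetricType R)
    (mu : {measure set (borel X) -> \bar R}) (Q : R) : Prop :=
  exists2 CA : R, 1 <= CA & forall (x : X) (r : R), 0 < r ->
    ((CA^-1 * r `^ Q)%:E <= mu (ball x r) <= (CA * r `^ Q)%:E)%E.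

Definition lower_assouad_codim (R : realType) (X : pmetricType R)
    (mu : {measure set (borel X) -> \bar R}) (E : set X) : \bar R :=
  ereal_sup (EFin @` [set rho : R | 0 <= rho /\
    exists2 C : R, 1 <= C & forall (x : X) (r R0 : R),
      E x -> 0 < r -> r < R0 -> (R0%:E < 2%:E * diam [set: X])%E ->
      (mu (open_nbhd E r `&` ball x R0) / mu (ball x R0)
         <= (C * (r / R0) `^ rho)%:E)%E]).

Definition Lip0 (R : realType) (X : metricType R) : set (X -> R) :=
  [set f | (exists L : R, forall x y, `|f x - f y| <= L * mdist x y) /\
           (exists (x : X) (r : R), 0 < r /\ forall y, ~ ball x r y -> f y = 0)].

Definition frac_energy (R : realType) (X : pmetricType R)
    (mu : {measure set (borel X) -> \bar R}) (s t : R) (f : X -> R) (y : X) :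
    \bar R :=
  (\int[mu]_(z in [set z : borel X | z <> y :> X])
     ((`|f y - f z| `^ t)%:E /
      ((mdist y (z : X) `^ (s * t))%:E * mu (ball y (mdist y (z : X))))))%E.

Definition frac_hardy_sobolev (R : realType) (X : pmetricType R)
    (mu : {measure set (borel X) -> \bar R}) (E : set X)
    (Q s p q t beta CH : R) : Prop :=
  forall f : X -> R, Lip0 f ->
    ((\int[mu]_x ((`|f x| `^ q)%:E *
         epow (delta E x) (q / p * (Q - s * p + beta) - Q))) `^ (q^-1)
     <= CH%:E *
        (\int[mu]_y (frac_energy mu s t f y `^ (p / t) *
           epow (delta E y) beta)) `^ (p^-1))%E.

(* Main.v *)
Require Import Defs.
From HB Require Import structures.
From mathcomp Require Import all_boot all_order all_algebra.
From mathcomp Require Import all_classical all_reals all_analysis.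
From mathcomp Require Import measurable_realfun ring lra.

Set Implicit Arguments.
Unset Strict Implicit.
Unset Printing Implicit Defensive.

Import Order.TTheory GRing.Theory Num.Theory.
Import numFieldNormedType.Exports.

Local Open Scope classical_set_scope.
Local Open Scope ring_scope.

(** Write [g := Q - q / p * (Q - s * p + beta)]. If [g <= 0] the claim is the
    assumption that the codimension is positive, so let [g > 0]; the weight on
    the left of the Hardy-Sobolev inequality is then the negative power
    [delta E `^ (- g)], equal to [+oo] on [E].

    Testing the inequality with a tent function of a ball [B(x, r)] centred in
    [E] gives [\int_(B(x, r)) delta E `^ (- g) <= K * r `^ (Q - g)]
    ([weight_ball_le]). Indeed the inner integral of the tent is at most
    [K * r `^ Q * (r + d(x, y)) `^ (- (Q + s * t))] ([tent_energy_le]), and as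
    [delta E y <= d(x, y)] the outer integrand decays like the power
    [s * p + Q * p / t - beta] of the distance. This exponent exceeds [Q],
    hence the outer integral converges, exactly when
    [Q - s * p + beta < Q * p / t]; that follows from [g > 0] and [t <= q].

    The bound on balls alone only says that the codimension is at least [g].
    The strict inequality comes from a hole-filling argument. Since the
    codimension is positive, there is [c > 0] such that the [c * r]-neighbourhood
    of [E] fills at most half of each ball [B(a, r)], [a] in [E]
    ([codim_gt0_porous]). Cover the part of the [r]-neighbourhood of [E] in a
    ball by balls of radius [3 * r] around a [2 * r]-separated net of points of
    [E]. On each of them the weight has integral at most a constant times
    [r `^ (Q - g)], while the disjoint sets [B(a, r)] minus the
    [c * r]-neighbourhood carry at least a constant times the same amount. So
    the weight of the neighbourhood is at most [L] times the weight of the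
    shell between distances [c * r] and [r] ([layer_weight_le_shell]), and adding
    [L] times the weight of the inner neighbourhood to both sides shows that
    passing from [r] to [c * r] multiplies the weight by at most [L / (1 + L)]
    ([hole_filling_step]). Iterating gives a geometric decay of ratio
    [theta = c `^ eps] with [eps > 0] ([layer_weight_decay]), and the weight is
    at least [r `^ (- g)] on the [r]-neighbourhood, so that the codimension is
    at least [g + eps] ([codim_gt_of_weight_ball_le]).

    Integrals of non-negative functions are suprema over simple functions
    below the integrand, hence monotone without any measurability; this spares
    all questions about the measurability of the fractional energy. *)

(** * Distance to a set and Borel measurability *)

Section distance_to_set.
Context (R : realType) (X : metricType R).
Implicit Types (E : set X) (x y z : X) (r : R).

Lemma in_ball x r y : ball x r y <-> mdist x y < r.
Proof. by rewrite ballEmdist. Qed.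

Lemma open_nbhdP E x r :
  open_nbhd E r x <-> exists2 a, E a & mdist x a < r.
Proof.
rewrite /open_nbhd /= /edist_inf; split => [/ereal_inf_lt[_ [a Ea <-]]|[a Ea]].
  by rewrite edist_mdist lte_fin => xa; exists a.
move=> xa; apply: (@le_lt_trans _ _ (edist (x, a))); last first.
  by rewrite edist_mdist lte_fin.
by apply: ereal_inf_lbound; exists a.
Qed.

Lemma edist_inf_fin_num E x : E !=set0 -> edist_inf E x \is a fin_num.
Proof.
move=> [a Ea]; rewrite ge0_fin_numE ?edist_inf_ge0//.
have : (edist_inf E x <= edist (x, a))%E by apply: ereal_inf_lbound; exists a.
by move=> /le_lt_trans; apply; rewrite edist_mdist ltry.
Qed.

Lemma delta_ge0 E x : 0 <= delta E x.
Proof. by rewrite fine_ge0// edist_inf_ge0. Qed.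

Lemma delta_le_mdist E x a : E a -> delta E x <= mdist x a.
Proof.
move=> Ea; rewrite -lee_fin fineK; last by apply: edist_inf_fin_num; exists a.
by rewrite -edist_mdist; apply: ereal_inf_lbound; exists a.
Qed.

Lemma open_nbhd_delta E x r : E !=set0 -> open_nbhd E r x <-> delta E x < r.
Proof. by move=> E0; rewrite -lte_fin fineK ?edist_inf_fin_num. Qed.

Lemma open_open_nbhd E r : open (open_nbhd E r).
Proof.
have -> : open_nbhd E r = edist_inf E @^-1` [set u | (u < r%:E)%E] by [].
apply: open_comp => [u _|]; first exact: edist_inf_continuous.
exact: open_ereal_lt_ereal.
Qed.

End distance_to_set.

Section borel_measurability.
Context (R : realType) (X : pmetricType R).
Implicit Types (E : set X) (x y z : X) (r : R).

Lemma borel_open (U : set X) : open U -> measurable (U : set (borel X)).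
Proof. by move=> Uo; apply: sub_sigma_algebra. Qed.

Lemma borel_open_nbhd E r : measurable (open_nbhd E r : set (borel X)).
Proof. exact: (borel_open (@open_open_nbhd _ _ E r)). Qed.

(** A ball is the neighbourhood of its centre, and this covers radii [r <= 0]. *)
Lemma borel_ball x r : measurable (ball x r : set (borel X)).
Proof.
suff -> : ball x r = open_nbhd [set x] r by exact: borel_open_nbhd.
apply/seteqP; split => y; last first.
  by move=> /open_nbhdP[_ ->]; rewrite metric_sym => /in_ball.
by move=> /in_ball xy; apply/open_nbhdP; exists x; rewrite // metric_sym.
Qed.

Lemma measurable_delta E :
  E !=set0 -> measurable_fun [set: borel X] (delta E).
Proof.
move=> E0 mT; apply: (measurability _ (RGenInftyO.measurableE R)) => //.
move=> /= _ [_ [r ->] <-]; rewrite setTI.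
rewrite (_ : _ @^-1` _ = open_nbhd E r); first exact: borel_open_nbhd.
by apply/seteqP; split => x /=; rewrite in_itv/= => /(open_nbhd_delta x r E0).
Qed.

Lemma measurable_epow_delta E (a : R) : E !=set0 ->
  measurable_fun [set: borel X] (fun x => epow (delta E x) a).
Proof.
move=> E0; rewrite /epow.
apply: measurable_fun_ifT => //.
- apply: measurable_and => //.
  apply: measurable_fun_eqr => //.
  exact: measurable_delta.
- apply/measurable_EFinP.
  apply: (measurableT_comp (measurable_powR a)); exact: measurable_delta.
Qed.

End borel_measurability.

Lemma epow_ge0 (R : realType) (x a : R) : (0 <= epow x a)%E.
Proof. by rewrite /epow; case: ifP => // _; rewrite lee_fin powR_ge0. Qed.

(** * Upper bounds of integrals by series over sets *)

Section integral_majorants.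
Context d (T : measurableType d) (R : realType).
Variable mu : {measure set T -> \bar R}.

(** Every simple function below [f] is below [g], so neither function has to be
    measurable. *)
Lemma ge0_le_integral_any (D : set T) (f g : T -> \bar R) :
  (forall x, D x -> 0 <= f x)%E -> (forall x, D x -> f x <= g x)%E ->
  (\int[mu]_(x in D) f x <= \int[mu]_(x in D) g x)%E.
Proof.
move=> f0 fg; rewrite !ge0_integralE//; last first.
  by move=> x Dx; exact: le_trans (f0 _ Dx) (fg _ Dx).
apply: le_ereal_sup => _ /= [h hf <-]; exists h => // x.
apply: (le_trans (hf x)); rewrite /patch; case: ifPn => // /set_mem Dx.
exact: fg.
Qed.

Lemma ge0_integral_le_majorant (D : set T) (f g : T -> \bar R) :
  (forall x, D x -> 0 <= f x)%E -> (forall x, 0 <= g x)%E ->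
  (forall x, D x -> f x <= g x)%E ->
  (\int[mu]_(x in D) f x <= \int[mu]_x g x)%E.
Proof.
move=> f0 g0 fg; rewrite integral_mkcond; apply: ge0_le_integral_any => x _.
  exact: erestrict_ge0.
by rewrite /patch; case: ifPn => // /set_mem; exact: fg.
Qed.

(** The majorant is the series of the [c n] times the indicators of the [A n].
    It turns a pointwise bound by [c n] on sets [A n] that cover the domain, such
    as dyadic balls, into a bound of the integral. *)
Lemma geometric_majorant (A : nat -> set T) (c : nat -> R) (a l : R) :
  (forall n, measurable (A n)) -> (forall n, 0 <= c n) -> 0 <= l < 1 ->
  (forall n, (c n)%:E * mu (A n) <= (a * l ^+ n)%:E)%E ->
  exists g : T -> \bar R,
    [/\ measurable_fun setT g, forall x, (0 <= g x)%E,
        forall n x, A n x -> ((c n)%:E <= g x)%E &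
        (\int[mu]_x g x <= (a / (1 - l))%:E)%E].
Proof.
move=> mA c0 /andP[l0 l1] cA.
pose f n x := ((c n)%:E * (\1_(A n) x)%:E)%E.
have f0 n x : (0 <= f n x)%E by rewrite mule_ge0 ?lee_fin.
have mf n : measurable_fun setT (f n).
  by apply: measurable_funeM; apply/measurable_EFinP; exact: measurable_indic.
exists (fun x => \sum_(n <oo) f n x)%E; split.
- exact: ge0_emeasurable_sum.
- by move=> x; apply: nneseries_ge0.
- move=> n x Anx; apply: le_trans (nneseries_lim_ge n.+1 _) => //.
  rewrite big_nat_recr//= {2}/f indicE mem_set// mule1.
  by rewrite leeDr// sume_ge0.
- rewrite integral_nneseries//.
  have int_f n : (\int[mu]_x f n x = (c n)%:E * mu (A n))%E.
    rewrite ge0_integralZl_EFin//; last first.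
      by apply/measurable_EFinP; exact: measurable_indic.
    by rewrite integral_indic// setIT.
  apply: lime_le; first by apply: is_cvg_nneseries => n _ _; exact: integral_ge0.
  apply: nearW => n.
  apply: (@le_trans _ _ (\sum_(0 <= k < n) (a * l ^+ k)%:E)%E).
    by apply: lee_sum => k _; rewrite int_f.
  have a0 : 0 <= a.
    have := cA 0%N; rewrite expr0 mulr1 => /(le_trans _); rewrite -lee_fin.
    by apply; rewrite mule_ge0// lee_fin.
  rewrite sumEFin lee_fin.
  have := congr1 (@^~ n) (geometric_seriesE a (negbT (lt_eqF l1))).
  rewrite /series/= => ->; rewrite ler_wpM2r ?invr_ge0 ?subr_ge0 ?(ltW l1)//.
  by rewrite ler_piMr// gerBl exprn_ge0.
Qed.

End integral_majorants.

(** * Real powers *)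

Section real_powers.
Context (R : realType).
Implicit Types (x y a b c : R) (n : nat).

Lemma powR_add x a b : 0 < x -> x `^ (a + b) = x `^ a * x `^ b.
Proof. by move=> x0; rewrite powRD// (gt_eqF x0) implybT. Qed.

Lemma powR_exprn x n a : 0 <= x -> (x ^+ n) `^ a = (x `^ a) ^+ n.
Proof.
by move=> x0; rewrite -powR_mulrn// powRAC powR_mulrn// powR_ge0.
Qed.

Lemma ler_powR_nneg x y a : 0 <= a -> 0 <= x -> x <= y -> x `^ a <= y `^ a.
Proof.
by move=> a0 x0 xy; apply: ge0_ler_powR => //; rewrite nnegrE// (le_trans x0).
Qed.

Lemma ger_powR_npos x y a : a <= 0 -> 0 < x -> x <= y -> y `^ a <= x `^ a.
Proof.
move=> a0 x0 xy; have y0 := lt_le_trans x0 xy.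
rewrite -(opprK a) !(powRN _ (- a)) lef_pV2 ?posrE ?powR_gt0//.
by apply: ler_powR_nneg; rewrite ?oppr_ge0// ltW.
Qed.

Lemma powR_le1 x a : 0 <= a -> 0 <= x <= 1 -> x `^ a <= 1.
Proof.
move=> a0 /andP[x0 x1]; rewrite (_ : 1 = 1 `^ a); last by rewrite powR1.
exact: ler_powR_nneg.
Qed.

Lemma powR_lt1 x a : 0 < x < 1 -> 0 < a -> 0 <= x `^ a < 1.
Proof.
move=> /andP[x0 x1] a0; rewrite powR_ge0/=.
rewrite (_ : 1 = 1 `^ a); last by rewrite powR1.
by apply: gt0_ltr_powR; rewrite ?nnegrE// ltW.
Qed.

(** The least exponent whose power of [c] falls below [x] is the successor of
    [n]. *)
Lemma geometric_scale c x : 0 < c < 1 -> 0 < x <= 1 ->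
  exists n, c ^+ n.+1 < x <= c ^+ n.
Proof.
move=> /andP[c0 c1] /andP[x0 x1].
have /ex_minnP[n cn nmin] : exists n, c ^+ n < x.
  have c1' : `|c| < 1 by rewrite gtr0_norm.
  have /cvgrPdist_lt/(_ x x0)[N _ cN] := cvg_expr c1'.
  exists N; have := cN N (leqnn N).
  by rewrite sub0r normrN ger0_norm// exprn_ge0// ltW.
case: n cn nmin => [|n] cn nmin; first by move: cn; rewrite expr0 ltNge x1.
exists n; rewrite cn/= leNgt; apply/negP => /nmin; by rewrite ltnn.
Qed.

End real_powers.

(** * Integrals of powers of the distance in an Ahlfors regular space *)

Section ahlfors_majorants.
Context (R : realType) (X : pmetricType R).
Variable mu : {measure set (borel X) -> \bar R}.
Variables (Q CA : R).
Hypothesis Q_ge0 : 0 <= Q.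
Hypothesis CA_gt0 : 0 < CA.
Hypothesis mu_ball_le : forall (x : X) (r : R), 0 < r ->
  (mu (ball x r) <= (CA * r `^ Q)%:E)%E.

(** The power [- (Q + b)] of the distance is integrable away from the centre: the
    dyadic ball of radius [2 ^ n * r] contributes at most a multiple of
    [(2 ^ n * r) `^ (- b)]. A majorant rather than the integral itself is
    produced, so that it can be added to another one whatever the
    measurability of the function that it bounds. *)
Lemma outer_majorant (b : R) : 0 < b -> exists2 K : R, 0 < K &
  forall (y : X) (r A : R), 0 < r -> 0 <= A ->
  exists g : borel X -> \bar R,
    [/\ measurable_fun setT g, forall z, (0 <= g z)%E,
        forall z : X, ((A * Num.max r (mdist y z) `^ (- (Q + b)))%:E <= g z)%E &
        (\int[mu]_z g z <= (A * (K * r `^ (- b)))%:E)%E].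
Proof.
move=> b0; pose l := 2^-1 `^ b.
have l01 : 0 <= l < 1 by apply: powR_lt1 => //; lra.
exists (CA * 2 `^ Q / (1 - l)).
  by rewrite divr_gt0 ?mulr_gt0 ?powR_gt0//; case/andP: l01; lra.
move=> y r A r0 A0.
(* A point at distance [d] is put in the ball of radius [2 * s n], where
   [s n <= Num.max r d < 2 * s n]. *)
pose s n := 2 ^+ n * r.
have s0 n : 0 < s n by rewrite mulr_gt0 ?exprn_gt0.
have [||||g [mg g0 gA gi]] := @geometric_majorant _ _ _ mu
    (fun n => ball y (2 * s n) : set (borel X))
    (fun n => A * s n `^ (- (Q + b))) (A * (CA * 2 `^ Q * r `^ (- b))) l.
- by move=> n; exact: borel_ball.
- by move=> n; rewrite mulr_ge0 ?powR_ge0.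
- by [].
- move=> n; have c0 : 0 <= A * s n `^ (- (Q + b)) by rewrite mulr_ge0 ?powR_ge0.
  have s20 : 0 < 2 * s n by rewrite mulr_gt0.
  apply: (le_trans (lee_wpmul2l _ (mu_ball_le y s20))); first by rewrite lee_fin.
  rewrite -EFinM lee_fin le_eqVlt; apply/orP; left; apply/eqP.
  have -> : l ^+ n = (2 ^+ n) `^ (- b).
    by rewrite powR_exprn// /l -powR_inv1// -powRrM mulN1r.
  rewrite [(2 * s n) `^ Q]powRM ?(ltW (s0 n))//.
  rewrite opprD powR_add// [s n `^ (- Q)]powRN.
  rewrite {2}/s [(2 ^+ n * r) `^ _]powRM ?exprn_ge0 ?(ltW r0)//.
  have : s n `^ Q != 0 by rewrite gt_eqF ?powR_gt0.
  by move=> ?; field.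
exists g; split => //.
- move=> z; set m := Num.max _ _.
  have rm : r <= m by rewrite /m le_max lexx.
  have m0 := lt_le_trans r0 rm.
  have [||n /andP[nl nu]] := @geometric_scale _ 2^-1 (r / m).
  + by apply/andP; split; lra.
  + by rewrite divr_gt0//= ler_pdivrMr// mul1r.
  have sm : s n <= m.
    move: nu; rewrite exprVn ler_pdivrMr//.
    rewrite -(ler_pM2l (_ : 0 < 2 ^+ n)) ?exprn_gt0//.
    by rewrite mulrA divff ?mul1r// expf_neq0.
  apply: le_trans (gA n z _).
    rewrite lee_fin ler_wpM2l//; apply: ger_powR_npos => //.
    by rewrite oppr_le0 addr_ge0// ltW.
  apply/in_ball; apply: (@le_lt_trans _ _ m).
    by rewrite /m le_max lexx orbT.
  move: nl; rewrite exprVn exprS ltr_pdivlMr//.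
  rewrite -(ltr_pM2l (_ : 0 < 2 * 2 ^+ n)) ?mulr_gt0 ?exprn_gt0//.
  by rewrite mulrA divff ?mul1r -?mulrA// mulf_neq0 ?expf_neq0.
- apply: (le_trans gi); rewrite lee_fin le_eqVlt; apply/orP; left; apply/eqP.
  by ring.
Qed.

(** The power [a - Q] of the distance is integrable near the centre: the dyadic
    ball of radius [2 ^ (- n) * r] contributes at most a multiple of
    [(2 ^ (- n) * r) `^ a]. *)
Lemma inner_majorant (a : R) : 0 < a -> exists2 K : R, 0 < K &
  forall (y : X) (r A : R), 0 < r -> 0 <= A ->
  exists g : borel X -> \bar R,
    [/\ measurable_fun setT g, forall z, (0 <= g z)%E,
        forall z : X, 0 < mdist y z <= r ->
          ((A * mdist y z `^ (a - Q))%:E <= g z)%E &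
        (\int[mu]_z g z <= (A * (K * r `^ a))%:E)%E].
Proof.
move=> a0; pose l := 2^-1 `^ a.
have l01 : 0 <= l < 1 by apply: powR_lt1 => //; lra.
exists (CA * 4 `^ Q / (1 - l)).
  by rewrite divr_gt0 ?mulr_gt0 ?powR_gt0//; case/andP: l01; lra.
move=> y r A r0 A0.
(* The distance lies in the interval from [s n / 2] (excluded) to [s n], which is
   inside the open ball of radius [2 * s n]. *)
pose s n := 2^-1 ^+ n * r.
have s0 n : 0 < s n by rewrite mulr_gt0 ?exprn_gt0.
pose c n := A * (s n `^ a * (2^-1 * s n) `^ (- Q)).
have c0 n : 0 <= c n by rewrite !mulr_ge0 ?powR_ge0.
have [||||g [mg g0 gA gi]] := @geometric_majorant _ _ _ mu
    (fun n => ball y (2 * s n) : set (borel X)) c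
    (A * (CA * 4 `^ Q * r `^ a)) l.
- by move=> n; exact: borel_ball.
- by [].
- by [].
- move=> n.
  have s20 : 0 < 2 * s n by rewrite mulr_gt0.
  apply: (le_trans (lee_wpmul2l _ (mu_ball_le y s20))); first by rewrite lee_fin.
  rewrite -EFinM lee_fin le_eqVlt; apply/orP; left; apply/eqP.
  have -> : l ^+ n = (2^-1 ^+ n) `^ a by rewrite powR_exprn.
  rewrite /c {1}/s [(_ * r) `^ _]powRM ?exprn_ge0//; last exact: ltW.
  rewrite (_ : 2 * s n = 4 * (2^-1 * s n)); last by field.
  rewrite [(4 * _) `^ Q]powRM//; last by rewrite ltW// mulr_gt0.
  rewrite powRN.
  have : (2^-1 * s n) `^ Q != 0 by rewrite gt_eqF ?powR_gt0 ?mulr_gt0.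
  by move=> ?; field.
exists g; split => //.
- move=> z /andP[d0 dr].
  have [||n /andP[nl nu]] := @geometric_scale _ 2^-1 (mdist y z / r).
  + by apply/andP; split; lra.
  + by rewrite divr_gt0//= ler_pdivrMr// mul1r.
  move: nl nu; rewrite ltr_pdivlMr// ler_pdivrMr// exprS -mulrA -/(s n) => nl nu.
  apply: le_trans (gA n z _).
    rewrite lee_fin ler_wpM2l// powR_add// ler_pM ?powR_ge0//.
      by apply: ler_powR_nneg => //; exact: ltW.
    by apply: ger_powR_npos; rewrite ?oppr_le0 ?mulr_gt0// ltW.
  by apply/in_ball/(le_lt_trans nu); rewrite ltr_pMl// ltr1n.
- apply: (le_trans gi); rewrite lee_fin le_eqVlt; apply/orP; left; apply/eqP.
  by ring.
Qed.

End ahlfors_majorants.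

(** * Fractional energy of a tent function *)

Section tent_function.
Context (R : realType) (X : metricType R).
Implicit Types (x y z : X) (r : R).

Definition tent x r y : R := Num.max 0 (Num.min 1 (2 - mdist x y / r)).

Lemma tent_ge0 x r y : 0 <= tent x r y.
Proof. by rewrite /tent le_max lexx. Qed.

Lemma tent_le1 x r y : tent x r y <= 1.
Proof. by rewrite /tent ge_max ler01 ge_min lexx. Qed.

Lemma tent_eq1 x r y : 0 < r -> mdist x y < r -> tent x r y = 1.
Proof.
move=> r0 xy; have : mdist x y / r <= 1 by rewrite ler_pdivrMr// mul1r ltW.
move=> ?; rewrite /tent min_l; last lra.
by rewrite max_r.
Qed.

Lemma tent_eq0 x r y : 0 < r -> 2 * r <= mdist x y -> tent x r y = 0.
Proof.
move=> r0 xy; have : 2 <= mdist x y / r by rewrite ler_pdivlMr.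
by move=> ?; rewrite /tent max_l// ge_min; apply/orP; right; lra.
Qed.

Lemma tent_dist_le1 x r y z : `|tent x r y - tent x r z| <= 1.
Proof.
have := tent_ge0 x r y; have := tent_ge0 x r z.
have := tent_le1 x r y; have := tent_le1 x r z.
by rewrite ler_norml => ? ? ? ?; apply/andP; split; lra.
Qed.

Lemma tent_lipschitz x r y z : 0 < r ->
  `|tent x r y - tent x r z| <= mdist y z / r.
Proof.
move=> r0.
have h1 : mdist x y / r <= mdist x z / r + mdist y z / r.
  rewrite -mulrDl ler_pM2r ?invr_gt0// [mdist y z]metric_sym.
  exact: metric_triangle.
have h2 : mdist x z / r <= mdist x y / r + mdist y z / r.
  by rewrite -mulrDl ler_pM2r ?invr_gt0//; exact: metric_triangle.
have h3 : 0 <= mdist y z / r by rewrite divr_ge0 ?mdist_ge0// ltW.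
rewrite /tent ler_norml.
set u := mdist x y / r in h1 h2 *; set v := mdist x z / r in h1 h2 *.
set w := mdist y z / r in h1 h2 h3 *.
by case: (leP 0 (Num.min 1 (2 - u))); case: (leP 0 (Num.min 1 (2 - v)));
  case: (leP 1 (2 - u)) => ?; case: (leP 1 (2 - v)) => ? ? ?;
  apply/andP; split; lra.
Qed.

Lemma tent_Lip0 x r : 0 < r -> Lip0 (tent x r).
Proof.
move=> r0; split.
  by exists r^-1 => y z; rewrite mulrC; exact: tent_lipschitz.
exists x, (2 * r); split; first by rewrite mulr_gt0.
by move=> y /in_ball/negP; rewrite -leNgt => /tent_eq0; exact.
Qed.

End tent_function.

Lemma frac_energy_ge0 (R : realType) (X : pmetricType R)
    (mu : {measure set (borel X) -> \bar R}) (s t : R) (f : X -> R) (y : X) :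
  (0 <= frac_energy mu s t f y)%E.
Proof.
apply: integral_ge0 => z _; apply: mule_ge0; first by rewrite lee_fin powR_ge0.
by rewrite inve_ge0 mule_ge0 ?lee_fin ?powR_ge0.
Qed.

Section energy_of_tent.
Context (R : realType) (X : pmetricType R).
Variable mu : {measure set (borel X) -> \bar R}.
Variables (Q CA s t : R).
Hypothesis Q_ge0 : 0 <= Q.
Hypothesis CA_gt0 : 0 < CA.
Hypothesis mu_ball_le : forall (x : X) (r : R), 0 < r ->
  (mu (ball x r) <= (CA * r `^ Q)%:E)%E.
Hypothesis mu_ball_ge : forall (x : X) (r : R), 0 < r ->
  ((CA^-1 * r `^ Q)%:E <= mu (ball x r))%E.
Hypothesis s_gt0 : 0 < s.
Hypothesis s_lt1 : s < 1.
Hypothesis t_gt0 : 0 < t.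

Let kernel (f : X -> R) (y z : X) : \bar R :=
  ((`|f y - f z| `^ t)%:E /
     ((mdist y z `^ (s * t))%:E * mu (ball y (mdist y z))))%E.

(** The lower Ahlfors bound controls the measure in the denominator. *)
Lemma kernel_bounds (f : X -> R) (y z : X) : y <> z ->
  (0 <= kernel f y z <=
    (`|f y - f z| `^ t * (CA * mdist y z `^ (- (Q + s * t))))%:E)%E.
Proof.
move=> /eqP yz; have d0 : 0 < mdist y z by rewrite mdist_gt0.
rewrite /kernel; set d := mdist y z in d0 *.
have := mu_ball_le y d0; have := mu_ball_ge y d0.
case: (mu (ball y d)) => [m| |]//; rewrite !lee_fin => m1 m2.
have dQ : 0 < d `^ Q by exact: powR_gt0.
have ds : 0 < d `^ (s * t) by exact: powR_gt0.
have m0 : 0 < m by apply: lt_le_trans m1; rewrite mulr_gt0 ?invr_gt0.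
rewrite -EFinM inver gt_eqF ?mulr_gt0// -EFinM !lee_fin.
rewrite mulr_ge0 ?powR_ge0 ?invr_ge0 ?mulr_ge0 ?powR_ge0 ?(ltW m0)//=.
rewrite ler_wpM2l ?powR_ge0// powRN powR_add//.
rewrite -[CA]invrK -invfM lef_pV2 ?posrE ?mulr_gt0 ?invr_gt0//.
by rewrite mulrA [leRHS]mulrC ler_pM2r.
Qed.

Lemma frac_energy_le_majorant (f : X -> R) (y : X) (g : borel X -> \bar R) :
  (forall z, 0 <= g z)%E ->
  (forall z : X, 0 < mdist y z ->
    ((`|f y - f z| `^ t * (CA * mdist y z `^ (- (Q + s * t))))%:E <= g z)%E) ->
  (frac_energy mu s t f y <= \int[mu]_z g z)%E.
Proof.
move=> g0 fg; apply: ge0_integral_le_majorant => // z /= zy.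
  by have /andP[] := @kernel_bounds f y z (fun e => zy (esym e)).
have /andP[_] := @kernel_bounds f y z (fun e => zy (esym e)).
move=> /le_trans; apply; apply: fg.
by rewrite mdist_gt0; apply/eqP => e; exact: (zy (esym e)).
Qed.

(** Near [y] the Lipschitz bound leaves the power [t - s * t - Q] of the distance,
    integrable at [y] as [s < 1]; far from [y] the bound by [1] leaves the power
    [- (Q + s * t)], integrable at infinity as [s > 0]. *)
Lemma tent_energy_near : exists2 K : R, 0 < K &
  forall (x y : X) (r : R), 0 < r ->
    (frac_energy mu s t (tent x r) y <= (K * r `^ (- (s * t)))%:E)%E.
Proof.
have a0 : 0 < t - s * t by rewrite subr_gt0 gtr_pMl.
have b0 : 0 < s * t by rewrite mulr_gt0.
have [K1 K10 inner] := inner_majorant Q_ge0 CA_gt0 mu_ball_le a0.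
have [K2 K20 outer] := outer_majorant Q_ge0 CA_gt0 mu_ball_le b0.
exists (CA * (K1 + K2)); first by rewrite mulr_gt0 ?addr_gt0.
move=> x y r r0.
have [|g1 [mg1 g10 Ag1 ig1]] := inner y r (CA * r `^ (- t)) r0.
  by rewrite mulr_ge0 ?powR_ge0 ?ltW.
have [g2 [mg2 g20 Ag2 ig2]] := outer y r CA r0 (ltW CA_gt0).
apply: (@le_trans _ _ (\int[mu]_z (g1 z + g2 z))%E).
  apply: frac_energy_le_majorant => [z|z d0]; first exact: adde_ge0.
  have [dr|rd] := leP (mdist y z) r.
    apply: (@le_trans _ _ (g1 z)); last by rewrite leeDl.
    apply: le_trans (Ag1 z _); last by rewrite d0 dr.
    rewrite lee_fin.
    apply: (@le_trans _ _
        ((mdist y z / r) `^ t * (CA * mdist y z `^ (- (Q + s * t))))).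
      rewrite ler_wpM2r ?mulr_ge0 ?powR_ge0 ?(ltW CA_gt0)//.
      apply: ler_powR_nneg; [exact: ltW|exact: normr_ge0|].
      exact: tent_lipschitz.
    rewrite powRM ?(ltW d0) ?invr_ge0 ?(ltW r0)// -[r^-1]powR_inv1 ?(ltW r0)//.
    rewrite -powRrM mulN1r.
    rewrite (_ : t - s * t - Q = t + - (Q + s * t)); last by ring.
    rewrite [X in _ <= _ * X]powR_add// le_eqVlt; apply/orP; left; apply/eqP.
    by ring.
  apply: (@le_trans _ _ (g2 z)); last by rewrite leeDr.
  apply: le_trans (Ag2 z); rewrite lee_fin (max_r (ltW rd)).
  rewrite ler_piMl ?mulr_ge0 ?powR_ge0 ?(ltW CA_gt0)//.
  by apply: powR_le1; [exact: ltW|rewrite normr_ge0 tent_dist_le1].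
rewrite ge0_integralD//.
apply: (le_trans (leeD ig1 ig2)).
rewrite -EFinD lee_fin (powR_add t)//.
have : r `^ t != 0 by rewrite gt_eqF ?powR_gt0.
rewrite [r `^ (- t)]powRN => ?; rewrite le_eqVlt; apply/orP; left; apply/eqP.
by field.
Qed.

(** Here the tent vanishes at [y], and it vanishes at [z] outside [B(x, 2 * r)].
    On that ball the distance from [y] is at least [d(x, y) - 2 * r], hence at least
    [d(x, y) / 2] and, by [r <= d(x, y) / 4], at least
    [2 / 5 * (r + d(x, y))]. *)
Lemma tent_energy_far (x y : X) (r : R) : 0 < r -> 4 * r <= mdist x y ->
  (frac_energy mu s t (tent x r) y <=
    (CA * (2 / 5 * (r + mdist x y)) `^ (- (Q + s * t)) *
       (CA * (2 * r) `^ Q))%:E)%E.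
Proof.
move=> r0 xy.
set c := CA * _.
have c0 : 0 <= c by rewrite mulr_ge0 ?powR_ge0 ?(ltW CA_gt0).
have r20 : 0 < 2 * r by rewrite mulr_gt0.
pose g (z : borel X) := (c%:E * (\1_(ball x (2 * r) : set (borel X)) z)%:E)%E.
apply: (@le_trans _ _ (\int[mu]_z g z)%E).
  apply: frac_energy_le_majorant => [z|z d0].
    by rewrite mule_ge0 ?lee_fin.
  have yE : tent x r y = 0 by apply: tent_eq0 => //; lra.
  rewrite yE sub0r normrN /g; have [zx|xz] := leP (2 * r) (mdist x z).
    rewrite tent_eq0// normr0 powR0 ?mul0r; last by rewrite gt_eqF.
    by rewrite mule_ge0 ?lee_fin.
  rewrite indicE mem_set ?mule1; last by apply/in_ball.
  rewrite lee_fin /c -[leRHS]mul1r ler_pM ?powR_ge0//.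
  - by rewrite mulr_ge0 ?powR_ge0 ?(ltW CA_gt0).
  - apply: powR_le1; first exact: ltW.
    by rewrite normr_ge0 ger0_norm ?tent_ge0 ?tent_le1.
  - rewrite ler_pM2l//; apply: ger_powR_npos.
    + by rewrite oppr_le0 addr_ge0// mulr_ge0 ?ltW.
    + by rewrite mulr_gt0// ?addr_gt0//; lra.
    + by have := metric_triangle x z y; rewrite [mdist z y]metric_sym; lra.
rewrite /g ge0_integralZl_EFin//; last first.
  apply/measurable_EFinP; apply: measurable_indic; exact: borel_ball.
rewrite integral_indic ?setIT//; last exact: borel_ball.
by rewrite [(c * _)%:E]EFinM lee_wpmul2l ?lee_fin// mu_ball_le.
Qed.

(** Where [d(x, y) < 4 * r], the sum [r + d(x, y)] is comparable to [r] and the bound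
    is that of [tent_energy_near]. *)
Lemma tent_energy_le : exists2 K : R, 0 < K &
  forall (x y : X) (r : R), 0 < r ->
    (frac_energy mu s t (tent x r) y <=
      (K * (r `^ Q * (r + mdist x y) `^ (- (Q + s * t))))%:E)%E.
Proof.
have b0 : 0 < Q + s * t by rewrite ltr_wpDl// mulr_gt0.
have [K1 K10 near] := tent_energy_near.
pose K2 := CA * (2 / 5) `^ (- (Q + s * t)) * (CA * 2 `^ Q).
have K20 : 0 < K2 by rewrite !mulr_gt0 ?powR_gt0//; lra.
have K30 : 0 < K1 * 5 `^ (Q + s * t) by rewrite mulr_gt0 ?powR_gt0.
exists (K1 * 5 `^ (Q + s * t) + K2); first by rewrite addr_gt0.
move=> x y r r0.
have [xy|xy] := leP (4 * r) (mdist x y).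
- apply: (le_trans (tent_energy_far r0 xy)); rewrite lee_fin.
  have d0 : 0 <= mdist x y by exact: mdist_ge0.
  have rd0 : 0 <= r + mdist x y by lra.
  have c0 : 0 <= 2 / 5 :> R by lra.
  rewrite [(2 / 5 * _) `^ _]powRM// [(2 * r) `^ _]powRM ?(ltW r0)//.
  rewrite (_ : _ * _ = K2 * (r `^ Q * (r + mdist x y) `^ (- (Q + s * t)))).
    by rewrite ler_wpM2r ?mulr_ge0 ?powR_ge0// lerDr ltW.
  by rewrite /K2; ring.
- apply: (le_trans (near x y r r0)); rewrite lee_fin.
  have d0 : 0 <= mdist x y by exact: mdist_ge0.
  apply: (@le_trans _ _ (K1 * 5 `^ (Q + s * t) *
     (r `^ Q * (r + mdist x y) `^ (- (Q + s * t))))); last first.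
    by rewrite ler_wpM2r ?mulr_ge0 ?powR_ge0// lerDl ltW.
  rewrite -mulrA ler_pM2l// mulrCA.
  have -> : r `^ (- (s * t)) = r `^ Q * r `^ (- (Q + s * t)).
    by rewrite -powR_add//; congr (_ `^ _); ring.
  rewrite ler_pM2l ?powR_gt0//.
  rewrite [X in _ <= _ * X](_ : _ =
    5 `^ (- (Q + s * t)) * ((r + mdist x y) / 5) `^ (- (Q + s * t))).
    rewrite mulrA -powR_add// subrr powRr0 mul1r.
    by apply: ger_powR_npos; rewrite ?oppr_le0 ?ltW//; lra.
  by rewrite -powRM//; [congr (_ `^ _); field|lra].
Qed.

End energy_of_tent.

(** * Testing the Hardy-Sobolev inequality with tents *)

Section testing_the_inequality.
Context (R : realType) (X : pmetricType R).
Variable mu : {measure set (borel X) -> \bar R}.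
Variables (Q CA s t p q beta CH : R) (E : set X).
Hypothesis Q_ge0 : 0 <= Q.
Hypothesis CA_gt0 : 0 < CA.
Hypothesis mu_ball_le : forall (x : X) (r : R), 0 < r ->
  (mu (ball x r) <= (CA * r `^ Q)%:E)%E.
Hypothesis mu_ball_ge : forall (x : X) (r : R), 0 < r ->
  ((CA^-1 * r `^ Q)%:E <= mu (ball x r))%E.
Hypothesis s_gt0 : 0 < s.
Hypothesis s_lt1 : s < 1.
Hypothesis t_gt0 : 0 < t.
Hypothesis p_gt0 : 0 < p.
Hypothesis q_gt0 : 0 < q.
Hypothesis beta_ge0 : 0 <= beta.

(** The hypothesis on the exponents is the convergence at infinity of the outer
    integral: [eta] is the excess over [Q] of the decay of its integrand. *)
Lemma tent_hardy_rhs_le : Q - s * p + beta < Q * (p / t) ->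
  exists2 K : R, 0 < K & forall (x : X) (r : R), E x -> 0 < r ->
    (\int[mu]_y (frac_energy mu s t (tent x r) y `^ (p / t) *
        epow (delta E y) beta) <= (K * r `^ (Q - s * p + beta))%:E)%E.
Proof.
rewrite -subr_gt0; set eta := _ - _ => eta0.
have pt0 : 0 <= p / t by rewrite divr_ge0 ?ltW.
have [K1 K10 energy] :=
  tent_energy_le Q_ge0 CA_gt0 mu_ball_le mu_ball_ge s_gt0 s_lt1 t_gt0.
have [K2 K20 outer] := outer_majorant Q_ge0 CA_gt0 mu_ball_le eta0.
exists (K1 `^ (p / t) * K2); first by rewrite mulr_gt0 ?powR_gt0.
move=> x r Ex r0.
pose A := K1 `^ (p / t) * r `^ (Q * (p / t)).
have A0 : 0 <= A by rewrite mulr_ge0 ?powR_ge0.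
have [g [mg g0 Ag ig]] := outer x r A r0 A0.
apply: (@le_trans _ _ (\int[mu]_z g z)%E).
  apply: ge0_integral_le_majorant => // y _.
    by rewrite mule_ge0 ?poweR_ge0 ?epow_ge0.
  apply: le_trans (Ag y).
  have d0 : 0 <= mdist x y by exact: mdist_ge0.
  have m0 : 0 < r + mdist x y by rewrite ltr_wpDr.
  apply: (@le_trans _ _ (A * (r + mdist x y) `^ (- (Q + eta)))%:E); last first.
    rewrite lee_fin ler_wpM2l//; apply: ger_powR_npos.
    - by rewrite oppr_le0 addr_ge0// ltW.
    - by rewrite lt_max r0.
    - by rewrite ge_max lerDl lerDr d0 ltW.
  have -> : A * (r + mdist x y) `^ (- (Q + eta)) =
      (K1 * (r `^ Q * (r + mdist x y) `^ (- (Q + s * t)))) `^ (p / t) *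
      (r + mdist x y) `^ beta.
    rewrite !powRM ?mulr_ge0 ?powR_ge0 ?(ltW K10)// -!powRrM /A.
    rewrite -!mulrA -[in RHS]powR_add//; do 2 congr (_ * _); congr (_ `^ _).
    by rewrite /eta; field; rewrite gt_eqF.
  rewrite EFinM; apply: lee_pmul; rewrite ?poweR_ge0 ?epow_ge0//.
    rewrite -poweR_EFin; apply: gt0_ler_poweR => //; last exact: energy.
      by rewrite in_itv/= leey frac_energy_ge0.
    by rewrite in_itv/= leey lee_fin !mulr_ge0 ?powR_ge0// ltW.
  rewrite /epow ltNge beta_ge0 andbF lee_fin.
  apply: ler_powR_nneg; rewrite ?delta_ge0//.
  apply: (le_trans (delta_le_mdist y Ex)).
  by rewrite metric_sym lerDr ltW.
apply: (le_trans ig); rewrite lee_fin /A.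
rewrite (_ : Q - s * p + beta = Q * (p / t) + - eta); last by rewrite /eta; ring.
by rewrite powR_add// le_eqVlt; apply/orP; left; apply/eqP; ring.
Qed.

Lemma poweR_inv_le (I : \bar R) (c : R) : (0 <= I)%E -> 0 <= c ->
  (I `^ q^-1 <= c%:E)%E -> (I <= (c `^ q)%:E)%E.
Proof.
move=> I0 c0 Ic; rewrite -[I]poweRe1// -[1](@mulVf _ q) ?gt_eqF// poweRrM.
rewrite -poweR_EFin; apply: gt0_ler_poweR => //; first exact: ltW.
  by rewrite in_itv/= leey poweR_ge0.
by rewrite in_itv/= leey lee_fin andbT.
Qed.

(** The tent equals [1] on [B(x, r)], so the left side of the inequality dominates
    the integral of the weight over this ball. *)
Lemma weight_ball_le : Q - s * p + beta < Q * (p / t) -> 0 < CH ->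
  frac_hardy_sobolev mu E Q s p q t beta CH ->
  exists2 K : R, 0 < K & forall (x : X) (r : R), E x -> 0 < r ->
    (\int[mu]_(y in (ball x r : set (borel X)))
        epow (delta E y) (q / p * (Q - s * p + beta) - Q) <=
      (K * r `^ (q / p * (Q - s * p + beta)))%:E)%E.
Proof.
move=> /tent_hardy_rhs_le[K K0 rhs] CH0 hardy.
exists (CH `^ q * K `^ (q / p)); first by rewrite mulr_gt0 ?powR_gt0.
move=> x r Ex r0; set a := _ - Q; set e := Q - s * p + beta.
pose I := (\int[mu]_y ((`|tent x r y| `^ q)%:E * epow (delta E y) a))%E.
have f0 y : (0 <= (`|tent x r y| `^ q)%:E * epow (delta E y) a)%E.
  by rewrite mule_ge0 ?lee_fin ?powR_ge0 ?epow_ge0.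
have I0 : (0 <= I)%E by exact: integral_ge0.
apply: (@le_trans _ _ I).
  apply: ge0_integral_le_majorant => // y; first by rewrite epow_ge0.
  by move=> /in_ball xy; rewrite tent_eq1// normr1 powR1 mul1e.
have -> : CH `^ q * K `^ (q / p) * r `^ (q / p * e) =
    (CH * (K * r `^ e) `^ p^-1) `^ q.
  rewrite !powRM ?mulr_ge0 ?powR_ge0 ?(ltW CH0) ?(ltW K0)//.
  rewrite -!powRrM mulrA.
  by congr (_ * _ `^ _ * _ `^ _); field; rewrite gt_eqF.
apply: poweR_inv_le => //; first by rewrite mulr_ge0 ?powR_ge0// ltW.
apply: (le_trans (hardy _ (tent_Lip0 x r0))).
rewrite EFinM lee_wpmul2l ?lee_fin ?(ltW CH0)// -poweR_EFin.
apply: gt0_ler_poweR.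
- by rewrite invr_ge0 ltW.
- rewrite in_itv/= leey andbT; apply: integral_ge0 => y _.
  by rewrite mule_ge0 ?poweR_ge0 ?epow_ge0.
- by rewrite in_itv/= leey lee_fin mulr_ge0 ?powR_ge0// ltW.
- exact: rhs.
Qed.

End testing_the_inequality.

(** * Hole filling *)

(** Widman's trick: add [L * u] to both sides of [u <= L * d]. *)
Lemma hole_filling_absorb (R : realType) (L : R) (u d v : \bar R) : 0 < L ->
  (0 <= u)%E -> (0 <= d)%E -> (u <= L%:E * d)%E -> (d + u <= v)%E ->
  (u <= (L / (1 + L))%:E * v)%E.
Proof.
move=> L0 u0 d0 uLd duv.
have L1 : 0 < 1 + L by rewrite addr_gt0.
have L0' : (0 <= L%:E)%E by rewrite lee_fin ltW.
rewrite mulrC EFinM -muleA lee_pdivlMl//.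
apply: le_trans (lee_wpmul2l L0' duv).
by rewrite EFinD ge0_muleDl// mul1e ge0_muleDr//; exact: leeD.
Qed.

Section hole_filling.
Context (R : realType) (X : pmetricType R).
Variable mu : {measure set (borel X) -> \bar R}.
Variables (Q CA K g c : R) (E : set X).
Hypothesis CA_gt0 : 0 < CA.
Hypothesis mu_ball_le : forall (x : X) (r : R), 0 < r ->
  (mu (ball x r) <= (CA * r `^ Q)%:E)%E.
Hypothesis mu_ball_ge : forall (x : X) (r : R), 0 < r ->
  ((CA^-1 * r `^ Q)%:E <= mu (ball x r))%E.
Hypothesis E_neq0 : E !=set0.
Hypothesis g_gt0 : 0 < g.
Hypothesis K_gt0 : 0 < K.
Hypothesis c_gt0 : 0 < c.
Hypothesis c_le : c <= 2^-1.

Let w (y : borel X) : \bar R := epow (delta E y) (- g).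

Hypothesis w_ball_le : forall (x : X) (r : R), E x -> 0 < r ->
  (\int[mu]_(y in (ball x r : set (borel X))) w y <= (K * r `^ (Q - g))%:E)%E.

Hypothesis E_porous : forall (x : X) (r : R), E x -> 0 < r ->
  (mu (ball x r `&` open_nbhd E (c * r)) <= 2^-1%:E * mu (ball x r))%E.

Let w_ge0 y : (0 <= w y)%E. Proof. exact: epow_ge0. Qed.

Let measurable_w (D : set (borel X)) : measurable_fun D w.
Proof. by apply: measurable_funTS; exact: measurable_epow_delta. Qed.

Let subset_int_w (A B : set (borel X)) : measurable A -> measurable B ->
  A `<=` B -> (\int[mu]_(y in A) w y <= \int[mu]_(y in B) w y)%E.
Proof. by move=> mA mB AB; apply: ge0_subset_integral. Qed.

Let shell (a : X) (r : R) : set (borel X) :=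
  ball a r `\` open_nbhd E (c * r).

Let measurable_shell a r : measurable (shell a r).
Proof. by apply: measurableD; [exact: borel_ball|exact: borel_open_nbhd]. Qed.

(** The weight is a decreasing function of the distance to [E]. *)
Lemma weight_nbhd_ge (A : set (borel X)) (r : R) : measurable A -> 0 < r ->
  A `<=` open_nbhd E r -> ((r `^ (- g))%:E * mu A <= \int[mu]_(y in A) w y)%E.
Proof.
move=> mA r0 AE; rewrite -integral_cst//; apply: ge0_le_integral_any => y Ay.
  by rewrite lee_fin powR_ge0.
have dr : delta E y < r by apply/open_nbhd_delta => //; exact: AE.
rewrite /w /epow oppr_lt0 g_gt0 andbT; case: ifPn => [_|d0]; first exact: leey.
rewrite lee_fin; apply: ger_powR_npos; last exact: ltW.
  by rewrite oppr_le0 ltW.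
by rewrite lt_neqAle eq_sym d0 delta_ge0.
Qed.

(** By porosity the neighbourhood removed from the ball takes at most half of its
    measure. *)
Lemma shell_measure_ge (a : X) (r : R) : E a -> 0 < r ->
  (((2 * CA)^-1 * r `^ Q)%:E <= mu (shell a r))%E.
Proof.
move=> Ea r0.
have : (mu (ball a r) =
    mu (shell a r) + mu (ball a r `&` open_nbhd E (c * r)))%E.
  by apply: measureDI; [exact: borel_ball|exact: borel_open_nbhd].
have := mu_ball_le a r0; have := mu_ball_ge a r0; have := E_porous Ea r0.
have : (0 <= mu (ball a r `&` open_nbhd E (c * r)))%E by exact: measure_ge0.
have : (0 <= mu (shell a r))%E by exact: measure_ge0.
case: (mu (shell a r)) => [u| |]; case: (mu (_ `&` _)) => [v| |];
  case: (mu (ball a r)) => [m| |]//.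
rewrite -EFinD -EFinM !lee_fin => u0 v0 vm mr _ [uvm].
rewrite invfM -mulrA; apply: le_trans (_ : 2^-1 * m <= _); last lra.
by rewrite ler_pM2l.
Qed.

Lemma balls_weight_le (s : seq X) (r : R) : 0 < r -> {in s, forall a, E a} ->
  (\int[mu]_(y in \big[setU/set0]_(a <- s) (ball a r : set (borel X))) w y <=
    ((size s)%:R * (K * r `^ (Q - g)))%:E)%E.
Proof.
move=> r0; elim: s => [|a s IH] sE; first by rewrite big_nil integral_set0 mul0r.
have ms : measurable (\big[setU/set0]_(a <- s) (ball a r : set (borel X))).
  by apply: bigsetU_measurable => b _; exact: borel_ball.
have mD := measurableD ms (borel_ball a r).
rewrite big_cons (_ : _ `|` _ = (ball a r : set (borel X)) `|`
  (\big[setU/set0]_(b <- s) (ball b r : set (borel X)) `\` ball a r)); last first.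
  by rewrite setUDr setDv setD0.
rewrite ge0_integral_setU//; last 2 first.
- exact: borel_ball.
- by rewrite disj_set2E setDIK.
rewrite /= -natr1 mulrDl mul1r addrC EFinD; apply: leeD; last first.
  by apply: w_ball_le => //; apply: sE; rewrite mem_head.
apply: le_trans (IH _); last by move=> b bs; apply: sE; rewrite inE bs orbT.
exact: subset_int_w.
Qed.

(** Balls of radius [r] around [2 * r]-separated points are disjoint, so the weights
    of the shells add up. *)
Lemma shells_weight_ge (s : seq X) (r : R) : 0 < r -> {in s, forall a, E a} ->
  pairwise (fun a b => 2 * r <= mdist a b) s ->
  (((size s)%:R * (r `^ (- g) * ((2 * CA)^-1 * r `^ Q)))%:E <=
    \int[mu]_(y in \big[setU/set0]_(a <- s) shell a r) w y)%E.
Proof.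
move=> r0; elim: s => [|a s IH] sE; first by rewrite big_nil integral_set0 mul0r.
rewrite pairwise_cons => /andP[/allP as_sep s_sep].
have Ea : E a by apply: sE; rewrite mem_head.
rewrite big_cons ge0_integral_setU//; last 2 first.
- exact: bigsetU_measurable.
- rewrite disj_set2E; apply/eqP; rewrite -subset0 => y [[/in_ball ay _]].
  rewrite -bigcup_seq => -[b /= bs [/in_ball yb _]].
  have := as_sep b bs; rewrite leNgt => /negP; apply.
  apply: (le_lt_trans (metric_triangle a y b)).
  by rewrite [mdist y b]metric_sym mulr_natl mulr2n ltrD.
rewrite /= -natr1 mulrDl mul1r addrC EFinD; apply: leeD.
  apply: (@le_trans _ _ ((r `^ (- g))%:E * mu (shell a r))%E).
    by rewrite EFinM lee_wpmul2l ?lee_fin ?powR_ge0// shell_measure_ge.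
  apply: weight_nbhd_ge => // y [/in_ball ay _]; apply/open_nbhdP.
  by exists a => //; rewrite metric_sym.
by apply: IH => // b bs; apply: sE; rewrite inE bs orbT.
Qed.

Let layer (x : X) (r rho : R) : set (borel X) :=
  open_nbhd E r `&` ball x rho.

Let measurable_layer x r rho : measurable (layer x r rho).
Proof. by apply: measurableI; [exact: borel_open_nbhd|exact: borel_ball]. Qed.

Let shells_sub (s : seq X) (x : X) (r rho : R) :
  {in s, forall a, E a /\ mdist x a < rho} ->
  \big[setU/set0]_(a <- s) shell a r `<=`
    layer x r (rho + r) `\` open_nbhd E (c * r).
Proof.
move=> sE y; rewrite -bigcup_seq => -[a /= /sE[Ea xa] [/in_ball ay yE]].
split=> //; split.
  by apply/open_nbhdP; exists a => //; rewrite metric_sym.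
by apply/in_ball; apply: (le_lt_trans (metric_triangle x a y)); rewrite ltrD.
Qed.

(** Otherwise points could be added for ever, and separated families of every size
    would exist in the ball; but each point accounts for a fixed amount [u] of the
    weight of the ball of radius [rho + r], which is finite. *)
Lemma exists_net (x : X) (r rho : R) : E x -> 0 < r -> 0 < rho ->
  exists s : seq X,
    [/\ {in s, forall a, E a /\ mdist x a < rho},
        pairwise (fun a b => 2 * r <= mdist a b) s &
        forall a, E a -> mdist x a < rho ->
          exists2 b, b \in s & mdist a b < 2 * r].
Proof.
move=> Ex r0 rho0; apply: contrapT => no_net.
have big n : exists s : seq X, [/\ {in s, forall a, E a /\ mdist x a < rho},
    pairwise (fun a b => 2 * r <= mdist a b) s & size s = n].
  elim: n => [|n [s [sE s_sep sn]]]; first by exists [::].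
  apply: contrapT => no_next; apply: no_net; exists s; split => // a Ea xa.
  apply: contrapT => a_far; apply: no_next; exists (a :: s); split => /=.
  - by move=> b; rewrite inE => /orP[/eqP->//|]; exact: sE.
  - rewrite s_sep andbT; apply/allP => b bs; rewrite leNgt; apply/negP => ab.
    by apply: a_far; exists b.
  - by rewrite sn.
pose u := r `^ (- g) * ((2 * CA)^-1 * r `^ Q).
have u0 : 0 < u by rewrite !mulr_gt0 ?powR_gt0 ?invr_gt0 ?mulr_gt0.
pose M := K * (rho + r) `^ (Q - g).
have [s [sE s_sep sn]] := big (Num.truncn (M / u)).+1.
have : (((size s)%:R * u)%:E <= M%:E)%E.
  apply: (le_trans (shells_weight_ge r0 (fun a sa => (sE a sa).1) s_sep)).
  apply: le_trans (w_ball_le Ex (addr_gt0 rho0 r0)).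
  apply: subset_int_w; [exact: bigsetU_measurable|exact: borel_ball|].
  by move=> y /(shells_sub sE)[[]].
rewrite lee_fin leNgt => /negP; apply.
rewrite -ltr_pdivrMr// sn; exact: truncnS_gt.
Qed.

(** Ratio of the upper bound of the weight on a ball of radius [3 * r] to the lower
    bound of the weight on a shell of outer radius [r]. *)
Let L := K * 3 `^ (Q - g) * (2 * CA).

(** A point at distance less than [r] from [E] is within [3 * r] of the net, and the
    shells around the net lie between the distances [c * r] and [r]. *)
Lemma layer_weight_le_shell (x : X) (r rho : R) : E x -> 0 < r -> 0 < rho ->
  (\int[mu]_(y in layer x r rho) w y <=
   L%:E * \int[mu]_(y in layer x r (rho + 2 * r) `\` open_nbhd E (c * r)) w y)%E.
Proof.
move=> Ex r0 rho0.
have [s [sE s_sep s_net]] := exists_net Ex r0 (addr_gt0 rho0 r0).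
have sE' : {in s, forall a, E a} by move=> a /sE[].
have r30 : 0 < 3 * r by rewrite mulr_gt0.
apply: (@le_trans _ _
    (\int[mu]_(y in \big[setU/set0]_(a <- s)
       (ball a (3 * r) : set (borel X))) w y)%E).
  apply: subset_int_w => //.
    by apply: bigsetU_measurable => b _; exact: borel_ball.
  move=> y [/open_nbhdP[a Ea ya] /in_ball xy].
  have [|b bs ab] := s_net a Ea.
    by apply: (le_lt_trans (metric_triangle x y a)); rewrite ltrD.
  rewrite -bigcup_seq; exists b => //=; apply/in_ball.
  rewrite metric_sym; apply: (le_lt_trans (metric_triangle y a b)).
  by rewrite (_ : 3 * r = r + 2 * r) ?ltrD//; ring.
apply: (le_trans (balls_weight_le r30 sE')).
have -> : (size s)%:R * (K * (3 * r) `^ (Q - g)) =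
    L * ((size s)%:R * (r `^ (- g) * ((2 * CA)^-1 * r `^ Q))).
  rewrite /L powRM ?(ltW r0)// [r `^ (Q - g)]powR_add//.
  by field; rewrite gt_eqF.
rewrite EFinM lee_wpmul2l//.
  by rewrite lee_fin !mulr_ge0 ?powR_ge0 ?(ltW K_gt0) ?(ltW CA_gt0).
apply: (le_trans (shells_weight_ge r0 sE' s_sep)).
apply: subset_int_w.
- exact: bigsetU_measurable.
- by apply: measurableD => //; exact: borel_open_nbhd.
- by rewrite (_ : rho + 2 * r = rho + r + r); [exact: shells_sub|ring].
Qed.

Let theta := L / (1 + L).

Let L_gt0 : 0 < L.
Proof. by rewrite !mulr_gt0 ?powR_gt0. Qed.

Lemma theta_in01 : 0 < theta < 1.
Proof.
have L1 : 0 < 1 + L by rewrite addr_gt0.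
by rewrite divr_gt0//= ltr_pdivrMr// mul1r ltrDr.
Qed.

(** The shell and the smaller neighbourhood are disjoint parts of the larger
    neighbourhood. *)
Lemma hole_filling_step (x : X) (r rho rho' : R) : E x -> 0 < r -> 0 < rho ->
  rho + 2 * r <= rho' ->
  (\int[mu]_(y in layer x (c * r) rho) w y <=
     theta%:E * \int[mu]_(y in layer x r rho') w y)%E.
Proof.
move=> Ex r0 rho0 rhoP.
have cr : c * r <= r by rewrite ger_pMl// (le_trans c_le)// invf_le1// ler1n.
set inner := (\int[mu]_(y in layer x (c * r) rho) w y)%E.
set outer := (\int[mu]_(y in layer x r rho') w y)%E.
pose D := layer x r (rho + 2 * r) `\` open_nbhd E (c * r).
have mD : measurable D by apply: measurableD => //; exact: borel_open_nbhd.
have rho_sub : ball x rho `<=` ball x (rho + 2 * r).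
  by move=> y /in_ball xy; apply/in_ball; apply: (lt_le_trans xy); lra.
have rho'_sub : ball x (rho + 2 * r) `<=` ball x rho'.
  by move=> y /in_ball xy; apply/in_ball; exact: lt_le_trans rhoP.
have nbhd_sub : open_nbhd E (c * r) `<=` open_nbhd E r.
  by move=> y /open_nbhdP[a Ea ya]; apply/open_nbhdP; exists a => //;
    exact: lt_le_trans cr.
have inner_shell : (inner <= L%:E * \int[mu]_(y in D) w y)%E.
  apply: le_trans (layer_weight_le_shell Ex r0 rho0).
  by apply: subset_int_w => // y [yE xy]; split => //; exact: nbhd_sub.
have shell_inner : (\int[mu]_(y in D) w y + inner <= outer)%E.
  rewrite -ge0_integral_setU//; last first.
    rewrite disj_set2E; apply/eqP; rewrite -subset0.
    by move=> y [[_ yE] [/yE]].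
  apply: subset_int_w => //; first exact: measurableU.
  move=> y [[[yE xy] _]|[yE xy]]; split => //; first exact: rho'_sub.
  - exact: nbhd_sub.
  - by apply: rho'_sub; exact: rho_sub.
have I0 : (0 <= inner)%E by exact: integral_ge0.
have D0 : (0 <= \int[mu]_(y in D) w y)%E by exact: integral_ge0.
exact: (hole_filling_absorb L_gt0 I0 D0 inner_shell shell_inner).
Qed.

(** Each step enlarges the ball by twice the current width [c ^+ n * r]. The radii
    [(1 + 4 * c ^+ n) * r] leave enough room for it because [c <= 1 / 2], and they
    remain between [r] and [5 * r]. *)
Lemma layer_weight_decay (x : X) (r : R) (n : nat) : E x -> 0 < r ->
  (\int[mu]_(y in layer x (c ^+ n * r) ((1 + 4 * c ^+ n) * r)) w y <=
     (theta ^+ n * (K * (5 * r) `^ (Q - g)))%:E)%E.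
Proof.
move=> Ex r0; have /andP[th0 _] := theta_in01.
have cn0 k : 0 < c ^+ k by rewrite exprn_gt0.
have radii k :
    (1 + 4 * c ^+ k.+1) * r + 2 * (c ^+ k * r) <= (1 + 4 * c ^+ k) * r.
  rewrite -subr_ge0 (_ : _ - _ = 4 * (2^-1 - c) * (c ^+ k * r)).
    by rewrite !mulr_ge0 ?subr_ge0// ltW.
  by rewrite exprS; field.
elim: n => [|n IH].
  have r5 : 0 < 5 * r by rewrite mulr_gt0.
  rewrite !expr0 !mul1r (_ : 1 + 4 * 1 = 5); last by ring.
  apply: le_trans (w_ball_le Ex r5).
  by apply: subset_int_w; [exact: measurable_layer|exact: borel_ball|move=> y []].
rewrite [X in layer x (X * _)]exprS -mulrA.
apply: (le_trans (hole_filling_step Ex _ _ (radii n))).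
- by rewrite mulr_gt0.
- by rewrite mulr_gt0// addr_gt0// mulr_gt0// exprn_gt0.
- by rewrite exprS -mulrA [(theta * _)%:E]EFinM lee_wpmul2l// lee_fin ltW.
Qed.

End hole_filling.

(** * Codimension *)

(** A positive exponent [rho] makes the factor [C * c `^ rho] at most [1 / 2] for
    small [c]. *)
Lemma codim_gt0_porous (R : realType) (X : pmetricType R)
    (mu : {measure set (borel X) -> \bar R}) (E : set X) :
  balls_finite_positive mu -> diam [set: X] = +oo%E ->
  (0 < lower_assouad_codim mu E)%E ->
  exists2 c : R, 0 < c <= 2^-1 & forall (x : X) (r : R), E x -> 0 < r ->
    (mu (ball x r `&` open_nbhd E (c * r)) <= 2^-1%:E * mu (ball x r))%E.
Proof.
move=> mu_fin X_oo /ereal_sup_gt[_ [rho [_ [C C1 codim]] <-]].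
rewrite lte_fin => rho0.
have C0 : 0 < C by exact: lt_le_trans C1.
pose c := Num.min 2^-1 ((2 * C)^-1 `^ rho^-1).
have c0 : 0 < c by rewrite lt_min invr_gt0 ltr0n powR_gt0 ?invr_gt0 ?mulr_gt0.
have c_le : c <= 2^-1 by rewrite ge_min lexx.
have c_rho : C * c `^ rho <= 2^-1.
  have : c `^ rho <= ((2 * C)^-1 `^ rho^-1) `^ rho.
    apply: ler_powR_nneg; [exact: ltW|exact: ltW|].
    by rewrite ge_min lexx orbT.
  rewrite -powRrM mulVf ?gt_eqF// powRr1 ?invr_ge0 ?mulr_ge0 ?(ltW C0)//.
  by move=> c_rho; rewrite mulrC -ler_pdivlMr// -invfM.
exists c; first by rewrite c0.
move=> x r Ex r0.
have crr : c * r < r by rewrite gtr_pMl// (le_lt_trans c_le)// invf_lt1// ltr1n.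
have := codim x (c * r) r Ex (mulr_gt0 c0 r0) crr.
rewrite X_oo gt0_muley ?lte_fin// ltry => /(_ isT).
rewrite mulfK ?gt_eqF// setIC.
have := mu_fin x r r0.
case: (mu (ball x r)) => [m| |]//; last by rewrite ltxx andbF.
rewrite !lte_fin => /andP[m0 _]; rewrite inver gt_eqF// lee_pdivrMr//.
move=> /le_trans; apply; rewrite lee_wpmul2r ?lee_fin//; exact: ltW.
Qed.

Lemma lower_assouad_codim_ge (R : realType) (X : pmetricType R)
    (mu : {measure set (borel X) -> \bar R}) (E : set X) (rho C : R) :
  balls_finite_positive mu -> 0 <= rho ->
  (forall (x : X) (r r' : R), E x -> 0 < r -> r < r' ->
    (mu (open_nbhd E r `&` ball x r') <=
      (C * (r / r') `^ rho)%:E * mu (ball x r'))%E) ->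
  (rho%:E <= lower_assouad_codim mu E)%E.
Proof.
move=> mu_fin rho0 muE; apply: ereal_sup_ubound; exists rho => //; split => //.
exists (Num.max 1 C); first by rewrite le_max lexx.
move=> x r r' Ex r0 rr' _.
have := muE x r r' Ex r0 rr'; have := mu_fin x r' (lt_trans r0 rr').
case: (mu (ball x r')) => [m| |]//; last by rewrite ltxx andbF.
rewrite !lte_fin => /andP[m0 _]; rewrite inver gt_eqF// lee_pdivrMr//.
move=> /le_trans; apply; rewrite lee_wpmul2r ?lee_fin ?(ltW m0)//.
by rewrite ler_wpM2r ?powR_ge0// le_max lexx orbT.
Qed.

(** Self-improvement: a Muckenhoupt type bound for the weight [delta E `^ (- g)] on
    balls centred in [E] holds for a slightly larger exponent too, in the weak
    form of the codimension. *)
Lemma codim_gt_of_weight_ball_le (R : realType) (X : pmetricType R)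
    (mu : {measure set (borel X) -> \bar R}) (Q CA K g : R) (E : set X) :
  balls_finite_positive mu -> diam [set: X] = +oo%E -> 0 < CA ->
  (forall (x : X) (r : R), 0 < r -> (mu (ball x r) <= (CA * r `^ Q)%:E)%E) ->
  (forall (x : X) (r : R), 0 < r -> ((CA^-1 * r `^ Q)%:E <= mu (ball x r))%E) ->
  E !=set0 -> (0 < lower_assouad_codim mu E)%E -> 0 < g -> 0 < K ->
  (forall (x : X) (r : R), E x -> 0 < r ->
    (\int[mu]_(y in (ball x r : set (borel X))) epow (delta E y) (- g) <=
      (K * r `^ (Q - g))%:E)%E) ->
  (g%:E < lower_assouad_codim mu E)%E.
Proof.
move=> mu_fin X_oo CA0 mu_le mu_ge E0 codim g0 K0 w_le.
have [c /andP[c0 c_le] porous] := codim_gt0_porous mu_fin X_oo codim.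
have c1 : c < 1 by rewrite (le_lt_trans c_le)// invf_lt1// ltr1n.
pose L := K * 3 `^ (Q - g) * (2 * CA); pose theta := L / (1 + L).
have /andP[th0 th1] : 0 < theta < 1 := theta_in01 Q g CA0 K0.
pose eps := ln theta / ln c.
have lnc : ln c < 0 by rewrite ln_lt0// c0.
have eps0 : 0 < eps by rewrite ltr_ndivlMr// mul0r ln_lt0// th0.
have c_eps : c `^ eps = theta.
  by rewrite /powR gt_eqF// /eps divfK ?lt_eqF// lnK.
apply: (@lt_le_trans _ _ (g + eps)%:E); first by rewrite lte_fin ltrDl.
apply: (@lower_assouad_codim_ge _ _ _ _ _
  (K * 5 `^ (Q - g) * c `^ (- eps) * CA)) => //.
  by rewrite addr_ge0 ?ltW.
move=> x r r' Ex r0 rr'.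
have r'0 := lt_trans r0 rr'.
have u0 : 0 < r / r' by rewrite divr_gt0.
(* The scale [c ^+ n * r'] is the smallest one of the decay that is at least [r]. *)
have [||n /andP[nl nu]] := @geometric_scale _ c (r / r').
- by rewrite c0.
- by rewrite u0 ler_pdivrMr// mul1r ltW.
have r_le : r <= c ^+ n * r' by rewrite -ler_pdivrMr.
pose A : set (borel X) := open_nbhd E r `&` ball x r'.
have mA : measurable A.
  by apply: measurableI; [exact: borel_open_nbhd|exact: borel_ball].
have A_decay : ((r `^ (- g))%:E * mu A <=
    (theta ^+ n * (K * (5 * r') `^ (Q - g)))%:E)%E.
  apply: (@le_trans _ _ (\int[mu]_(y in A) epow (delta E y) (- g))%E).
    by apply: weight_nbhd_ge => // y [].
  apply: le_trans (layer_weight_decay CA0 mu_le mu_ge E0 g0 K0 c0 c_le w_le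
    porous n Ex r'0).
  apply: ge0_subset_integral => //.
  - by apply: measurableI; [exact: borel_open_nbhd|exact: borel_ball].
  - by apply: measurable_funTS; exact: measurable_epow_delta.
  - by move=> y _; exact: epow_ge0.
  - move=> y [/open_nbhdP[a Ea ya] /in_ball xy]; split.
      by apply/open_nbhdP; exists a => //; exact: lt_le_trans r_le.
    apply/in_ball/(lt_le_trans xy); rewrite mulrDl mul1r lerDl.
    by rewrite !mulr_ge0// ?exprn_ge0// ltW.
have th_le : theta ^+ n <= c `^ (- eps) * (r / r') `^ eps.
  rewrite -c_eps -powR_exprn ?(ltW c0)//.
  have cE : c ^+ n = c^-1 * c ^+ n.+1 by rewrite exprS mulKf// gt_eqF.
  rewrite cE [X in X <= _]powRM ?invr_ge0 ?exprn_ge0 ?(ltW c0)//.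
  rewrite -[c^-1]powR_inv1 ?(ltW c0)// -powRrM mulN1r ler_wpM2l ?powR_ge0//.
  by apply: ler_powR_nneg; rewrite ?exprn_ge0 ?(ltW c0) ?(ltW eps0) ?(ltW nl).
rewrite -/A; move: A_decay; rewrite powRN.
rewrite lee_pdivrMl ?powR_gt0// => /le_trans; apply.
apply: (@le_trans _ _ ((K * 5 `^ (Q - g) * c `^ (- eps) * CA *
    (r / r') `^ (g + eps))%:E * (CA^-1 * r' `^ Q)%:E)%E); last first.
  rewrite lee_wpmul2l ?mu_ge// lee_fin.
  by rewrite !mulr_ge0 ?powR_ge0 ?(ltW K0) ?(ltW CA0).
rewrite -!EFinM lee_fin.
apply: (@le_trans _ _ (r `^ g * ((c `^ (- eps) * (r / r') `^ eps) *
    (K * (5 * r') `^ (Q - g))))).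
  rewrite ler_wpM2l ?powR_ge0// ler_wpM2r// mulr_ge0 ?powR_ge0//; exact: ltW.
rewrite le_eqVlt; apply/orP; left; apply/eqP.
rewrite [(r / r') `^ (g + eps)]powR_add//.
rewrite [(r / r') `^ g]powRM ?invr_ge0 ?(ltW r0) ?(ltW r'0)//.
rewrite [(5 * r') `^ _]powRM ?(ltW r'0)// [r' `^ (Q - g)]powR_add//.
have -> : r'^-1 `^ g = r' `^ (- g).
  by rewrite -[r'^-1]powR_inv1 ?(ltW r'0)// -powRrM mulN1r.
by field; rewrite gt_eqF.
Qed.

Theorem proposition5p5 (R : realType) (X : pmetricType R)
    (mu : {measure set (borel X) -> \bar R})
    (mu_balls : balls_finite_positive mu)
    (mu_doubling : doubling mu)
    (X_unbounded : diam [set: X] = +oo%E)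
    (mu_points : forall x : X, mu [set x] = 0%E)
    (annuli : forall (x : X) (r R0 : R), 0 < r -> r < R0 ->
       ball x R0 `\` ball x r !=set0)
    (s Q : R) (s_gt0 : 0 < s) (s_lt1 : s < 1) (Q_gts : s < Q)
    (mu_ahlfors : ahlfors_regular mu Q)
    (E : set X) (E_neq0 : E !=set0) (E_closed : closed E)
    (E_codim : (0 < lower_assouad_codim mu E)%E)
    (p q beta : R) (p_gt1 : 1 < p) (p_leq : p <= q)
    (sp_ltQ : s * p < Q) (q_le : q <= Q * p / (Q - s * p))
    (beta_ge0 : 0 <= beta)
    (t CH : R) (t_ge1 : 1 <= t) (t_leq : t <= q) (CH_gt0 : 0 < CH)
    (hardy : frac_hardy_sobolev mu E Q s p q t beta CH) :
  (lower_assouad_codim mu E > (Q - q / p * (Q - s * p + beta))%:E)%E.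
Proof.
set g := Q - _.
have [g_le0|g0] := leP g 0.
  by apply: le_lt_trans E_codim; rewrite lee_fin.
have Q0 : 0 < Q by exact: lt_trans Q_gts.
have p0 : 0 < p by exact: lt_trans p_gt1.
have q0 : 0 < q by exact: lt_le_trans p_leq.
have t0 : 0 < t by exact: lt_le_trans t_ge1.
have [CA CA1 ahlfors] := mu_ahlfors.
have CA0 : 0 < CA by exact: lt_le_trans CA1.
have mu_le x r : 0 < r -> (mu (ball x r) <= (CA * r `^ Q)%:E)%E.
  by move=> /(ahlfors x)/andP[].
have mu_ge x r : 0 < r -> ((CA^-1 * r `^ Q)%:E <= mu (ball x r))%E.
  by move=> /(ahlfors x)/andP[].
(* The first step is [g > 0] multiplied by [p / q]; the second is [t <= q]. *)
have decay : Q - s * p + beta < Q * (p / t).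
  have : Q - s * p + beta < Q * (p / q).
    move: g0; rewrite subr_gt0 mulrAC ltr_pdivrMr// [Q * (p / q)]mulrA.
    by rewrite ltr_pdivlMr// mulrC.
  move=> /lt_le_trans; apply; rewrite ler_pM2l// ler_pM2l//.
  by rewrite lef_pV2.
have [K K0 w_le] := weight_ball_le (ltW Q0) CA0 mu_le mu_ge s_gt0 s_lt1 t0 p0 q0
  beta_ge0 decay CH_gt0 hardy.
apply: (codim_gt_of_weight_ball_le mu_balls X_unbounded CA0 mu_le mu_ge E_neq0
  E_codim g0 K0) => x r Ex r0.
have -> : Q - g = q / p * (Q - s * p + beta) by rewrite subKr.
have -> : - g = q / p * (Q - s * p + beta) - Q by rewrite opprB.
exact: w_le.
Qed.
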